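(* Let $A$ be a Boolean algebra. Then $A\in\mathcal{B}\mathcal{M}_+$ if and only if $A$ is (isomorphic to) a product $\prod\{A_\gamma\mid\gamma\in\Gamma\}$ of Boolean algebras over some set $\Gamma$ where, for every $\gamma\in\Gamma$, $A_\gamma$ is a complete Boolean algebra having a dense countable subset.
   Context: $\mathcal{M}_+$ is the class of all regular Hausdorff spaces $X$ which can be written as a topological sum $X=\bigoplus\{X_\gamma\mid\gamma\in\Gamma\}$, where $\Gamma$ is an arbitrary set and $w(X_\gamma)\le\aleph_0$ for every $\gamma\in\Gamma$ ($w$ = weight). $\mathcal{B}\mathcal{M}_+$ is the class of all Boolean algebras isomorphic to $RO(X)$ for some $X\in\mathcal{M}_+$, where $RO(X)$ is the Boolean algebra of regular open subsets of $X$ (those $U$ with $U=\mathrm{int}(\mathrm{cl}(U))$, ordered by inclusion). A subset $B$ of a Boolean algebra $A$ is dense if for every $a\in A\setminus\{0\}$ there is $b\in B\setminus\{0\}$ with $b\le a$. Countable means of cardinality at most $\aleph_0$. The product of Boolean algebras is the Cartesian product with coordinate-wise operations; degenerate Boolean algebras ($0=1$) are allowed. *)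

(* Defs.v *)
From HB Require Import structures.
From mathcomp Require Import all_boot all_order.
From mathcomp Require Import all_classical.
From mathcomp Require Import topology.

Set Implicit Arguments.
Unset Strict Implicit.
Unset Printing Implicit Defensive.

Import Order.Theory.

Local Open Scope classical_set_scope.

(* Boolean algebras are ctbDistrLatticeType (complemented distributive lattices
   with 0 and 1); 0 = 1 is not excluded. The [Order.disp_t] parameters are
   phantom arguments that only control notation. *)

Section BooleanAlgebras.
Context {d d' : Order.disp_t}.
Local Open Scope order_scope.

(* The library's {tblmorphism A -> B} is not used: it only requires
   preservation of \bot and \top. *)
Definition ba_isomorphism (A : ctbDistrLatticeType d)
    (B : ctbDistrLatticeType d') (f : A -> B) : Prop :=
  [/\ bijective f,
      {morph f : x y / x `&` y >-> x `&` y},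
      {morph f : x y / x `|` y >-> x `|` y},
      {morph f : x / ~` x >-> ~` x}
    & f \bot = \bot /\ f \top = \top].

Definition ba_isomorphic (A : ctbDistrLatticeType d)
    (B : ctbDistrLatticeType d') : Prop :=
  exists f : A -> B, ba_isomorphism f.

Definition ba_complete (A : ctbDistrLatticeType d) : Prop :=
  forall S : set A, supremums S !=set0 /\ infimums S !=set0.

Definition ba_dense (A : ctbDistrLatticeType d) (S : set A) : Prop :=
  forall a : A, a != \bot -> exists b : A, [/\ S b, b != \bot & b <= a].

End BooleanAlgebras.

Fact ba_prod_display : Order.disp_t. Proof. exact: Order.Disp tt tt. Qed.

(* The alias keeps these instances apart from the library's order on
   non-dependent functions. *)
Definition ba_prod (G : Type) (d : G -> Order.disp_t)
  (B : forall g, ctbDistrLatticeType (d g)) : Type := forall g, B g.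

Section BooleanProduct.
Context {G : Type} {d : G -> Order.disp_t}.
Context {B : forall g, ctbDistrLatticeType (d g)}.
Local Open Scope order_scope.
Local Notation P := (ba_prod B).
Implicit Types x y z : P.

HB.instance Definition _ := Choice.copy P (forall g, B g).

Definition ba_prod_le x y : bool := `[< forall g, x g <= y g >].
Definition ba_prod_meet x y : P := fun g => x g `&` y g.
Definition ba_prod_join x y : P := fun g => x g `|` y g.
Definition ba_prod_bot : P := fun g => \bot.
Definition ba_prod_top : P := fun g => \top.
Definition ba_prod_compl x : P := fun g => ~` x g.

Fact ba_prod_le_refl : reflexive ba_prod_le.
Proof. by move=> x; apply/asboolP => g. Qed.

Fact ba_prod_le_anti : antisymmetric ba_prod_le.
Proof.
move=> x y /andP[/asboolP xy /asboolP yx]; apply: functional_extensionality_dep.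
by move=> g; apply: le_anti; rewrite xy yx.
Qed.

Fact ba_prod_le_trans : transitive ba_prod_le.
Proof.
move=> y x z /asboolP xy /asboolP yz; apply/asboolP => g.
exact: le_trans (xy g) (yz g).
Qed.

HB.instance Definition _ := Order.Le_isPOrder.Build ba_prod_display P
  ba_prod_le_refl ba_prod_le_anti ba_prod_le_trans.

Fact ba_prod_leP x y : reflect (forall g, x g <= y g) (x <= y).
Proof. exact: asboolP. Qed.

Fact ba_prod_meetP x y z :
  (x <= ba_prod_meet y z) = (x <= y) && (x <= z).
Proof.
apply/ba_prod_leP/andP => [xyz|[/ba_prod_leP xy /ba_prod_leP xz] g]; last first.
  by rewrite lexI xy xz.
by split; apply/ba_prod_leP => g; have := xyz g; rewrite lexI => /andP[].
Qed.

Fact ba_prod_joinP x y z :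
  (ba_prod_join x y <= z) = (x <= z) && (y <= z).
Proof.
apply/ba_prod_leP/andP => [xyz|[/ba_prod_leP xz /ba_prod_leP yz] g]; last first.
  by rewrite leUx xz yz.
by split; apply/ba_prod_leP => g; have := xyz g; rewrite leUx => /andP[].
Qed.

HB.instance Definition _ := Order.POrder_MeetJoin_isLattice.Build
  ba_prod_display P ba_prod_meetP ba_prod_joinP.

Fact ba_prod_meetUl : @left_distributive P P ba_prod_meet ba_prod_join.
Proof.
by move=> x y z; apply: functional_extensionality_dep => g; exact: meetUl.
Qed.

HB.instance Definition _ := Order.Lattice_Meet_isDistrLattice.Build
  ba_prod_display P ba_prod_meetUl.

Fact ba_prod_le0x x : ba_prod_bot <= x.
Proof. by apply/ba_prod_leP => g; exact: le0x. Qed.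

Fact ba_prod_lex1 x : x <= ba_prod_top.
Proof. by apply/ba_prod_leP => g; exact: lex1. Qed.

HB.instance Definition _ :=
  Order.hasBottom.Build ba_prod_display P ba_prod_le0x.
HB.instance Definition _ :=
  Order.hasTop.Build ba_prod_display P ba_prod_lex1.

Fact ba_prod_joinxC x : x `|` ba_prod_compl x = \top.
Proof. by apply: functional_extensionality_dep => g; exact: joinxC. Qed.

Fact ba_prod_meetxC x : x `&` ba_prod_compl x = \bot.
Proof. by apply: functional_extensionality_dep => g; exact: meetxC. Qed.

HB.instance Definition _ := Order.TBDistrLattice_hasComplement.Build
  ba_prod_display P ba_prod_joinxC ba_prod_meetxC.

End BooleanProduct.

Fact RO_display : Order.disp_t. Proof. exact: Order.Disp tt tt. Qed.

Record RO (X : topologicalType) : Type :=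
  MkRO { RO_set :> set X ; RO_setP : regopen RO_set }.

Section RegularOpenAlgebra.
Context {X : topologicalType}.
Implicit Types (A : set X) (U V W : RO X).

HB.instance Definition _ := gen_eqMixin (RO X).
HB.instance Definition _ := gen_choiceMixin (RO X).

Fact RO_inj U V : RO_set U = RO_set V -> U = V.
Proof.
case: U V => [U rU] [V rV] /= UV; rewrite UV in rU *.
by congr MkRO; exact: Prop_irrelevance.
Qed.

Fact RO_open U : open (RO_set U).
Proof. by rewrite -RO_setP; exact: open_interior. Qed.

Fact regopen_interior_closure A : regopen (interior (closure A)).
Proof. exact/interior_closed_regopen/closed_closure. Qed.

Fact regopen_RO_compl U : regopen (interior (~` U)).
Proof. exact/interior_closed_regopen/open_closedC/RO_open. Qed.

Fact interior_closureI A W :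
  interior (closure A) `&` W `<=` interior (closure (A `&` W)).
Proof.
have oW := RO_open W.
have oAW : open (interior (closure A) `&` W).
  by apply: openI => //; exact: open_interior.
rewrite -[X in X `<=` _](iffLR (interior_id _) oAW); apply: interiorS.
move=> x [/interior_subset clAx Wx] N xN.
have [] := clAx (N `&` W); first by apply: filterI => //; exact: open_nbhs_nbhs.
by move=> y [Ay [Ny Wy]]; exists y.
Qed.

Fact regopenI U V : regopen (U `&` V).
Proof.
rewrite /regopen eqEsubset; split=> [x clx|x [Ux Vx]].
  by split; rewrite -RO_setP; move: x clx; apply: interiorS; apply: closureS;
    [exact: subIsetl|exact: subIsetr].
apply: interior_closureI; split=> //; rewrite RO_setP //.
Qed.

Definition RO_le U V : bool := `[< RO_set U `<=` RO_set V >].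
Definition RO_meet U V : RO X := MkRO (regopenI U V).
Definition RO_join U V : RO X := MkRO (regopen_interior_closure (U `|` V)).
Definition RO_compl U : RO X := MkRO (regopen_RO_compl U).

Fact regopen0 : regopen (@set0 X).
Proof. by rewrite /regopen closure0 interior0. Qed.
Fact regopenT : regopen [set: X].
Proof. by rewrite /regopen closureT interiorT. Qed.

Definition RO_bot : RO X := MkRO regopen0.
Definition RO_top : RO X := MkRO regopenT.

Fact RO_le_refl : reflexive RO_le.
Proof. by move=> U; apply/asboolP. Qed.

Fact RO_le_anti : antisymmetric RO_le.
Proof.
by move=> U V /andP[/asboolP UV /asboolP VU]; apply: RO_inj; rewrite eqEsubset.
Qed.

Fact RO_le_trans : transitive RO_le.
Proof.
move=> V U W /asboolP UV /asboolP VW; apply/asboolP.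
exact: subset_trans UV VW.
Qed.

HB.instance Definition _ := Order.Le_isPOrder.Build RO_display (RO X)
  RO_le_refl RO_le_anti RO_le_trans.

Fact RO_leP U V : reflect (RO_set U `<=` RO_set V) (U <= V)%O.
Proof. exact: asboolP. Qed.

Fact RO_meetP U V W : (U <= RO_meet V W)%O = (U <= V)%O && (U <= W)%O.
Proof.
apply/RO_leP/andP => /=; first by rewrite subsetI => -[? ?]; split; apply/RO_leP.
by move=> [/RO_leP ? /RO_leP ?]; rewrite subsetI.
Qed.

Fact RO_joinP U V W : (RO_join U V <= W)%O = (U <= W)%O && (V <= W)%O.
Proof.
have sub A : open A -> A `<=` interior (closure A).
  by move=> oA; rewrite -open_subsetE //; exact: subset_closure.
apply/RO_leP/andP => [UVW|[/RO_leP UW /RO_leP VW]] /=.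
  have : RO_set U `|` RO_set V `<=` RO_set W.
    apply: subset_trans UVW; apply: sub; apply: openU; exact: RO_open.
  by rewrite subUset => -[? ?]; split; apply/RO_leP.
rewrite -[X in _ `<=` X](RO_setP W); apply: interiorS; apply: closureS.
by rewrite subUset.
Qed.

HB.instance Definition _ := Order.POrder_MeetJoin_isLattice.Build
  RO_display (RO X) RO_meetP RO_joinP.

Fact RO_meetUl : @left_distributive (RO X) (RO X) RO_meet RO_join.
Proof.
move=> U V W; apply: RO_inj; rewrite /= -setIUl eqEsubset; split.
  exact: interior_closureI.
rewrite subsetI; split; first by apply/interiorS/closureS; exact: subIsetl.
rewrite -[X in _ `<=` X](RO_setP W).
by apply/interiorS/closureS; exact: subIsetr.
Qed.

HB.instance Definition _ := Order.Lattice_Meet_isDistrLattice.Build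
  RO_display (RO X) RO_meetUl.

Fact RO_le0x U : (RO_bot <= U)%O.
Proof. by apply/RO_leP; exact: sub0set. Qed.

Fact RO_lex1 U : (U <= RO_top)%O.
Proof. by apply/RO_leP; exact: subsetT. Qed.

HB.instance Definition _ := Order.hasBottom.Build RO_display (RO X) RO_le0x.
HB.instance Definition _ := Order.hasTop.Build RO_display (RO X) RO_lex1.

Fact RO_joinxC U : RO_join U (RO_compl U) = RO_top.
Proof.
apply: RO_inj => /=; rewrite interiorC closureU.
suff -> : closure U `|` closure (~` closure U) = setT by exact: interiorT.
rewrite -subTset -(setUv (closure U)); apply: setUS; exact: subset_closure.
Qed.

Fact RO_meetxC U : RO_meet U (RO_compl U) = RO_bot.
Proof.
apply: RO_inj => /=; rewrite -subset0 => x [Ux /interior_subset]; exact.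
Qed.

HB.instance Definition _ := Order.TBDistrLattice_hasComplement.Build
  RO_display (RO X) RO_joinxC RO_meetxC.

End RegularOpenAlgebra.

Definition homeomorphic (X Y : topologicalType) : Prop :=
  exists (f : X -> Y) (g : Y -> X),
    [/\ cancel f g, cancel g f, continuous f & continuous g].

(* [second_countable] says that the weight is at most aleph_0; {g : G & Y g}
   carries the library's topological-sum topology. *)
Definition M_plus (X : topologicalType) : Prop :=
  [/\ regular_space X, hausdorff_space X &
    exists (G : choiceType) (Y : G -> topologicalType),
      (forall g, @second_countable (Y g)) /\ homeomorphic X {g : G & Y g}].

Definition BM_plus (d : Order.disp_t) (A : ctbDistrLatticeType d) : Prop :=
  exists2 X : topologicalType, M_plus X & ba_isomorphic A (RO X).

(* Main.v *)
(* A topological sum has [RO (+)_g Y_g = prod_g RO Y_g], and [RO Y] is complete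
   and, when [Y] is second countable, has the interiors of the closures of the
   basic open sets as a countable dense subset.  Conversely, let [B] be complete
   and [e] enumerate a dense subset.  The sequences of bits [p] for which every
   finite meet [m_n p] of the elements [e i] or [~ e i], [i < n], selected by
   [p] is nonzero form a subspace of Cantor space (the Stone space of the
   subalgebra generated by [e]), and [b |-> {p | m_n p <= b for some n}] is an
   isomorphism of [B] onto its regular open algebra; completeness gives its
   surjectivity, density its injectivity and the regularity of its values. *)

Require Import Defs.
From HB Require Import structures.
From mathcomp Require Import all_boot all_order.
From mathcomp Require Import all_classical.
From mathcomp Require Import topology.

Set Implicit Arguments.
Unset Strict Implicit.
Unset Printing Implicit Defensive.

Import Order.Theory.

Local Open Scope classical_set_scope.

(** * Isomorphisms of Boolean algebras, and completeness *)

Section Isomorphisms.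
Local Open Scope order_scope.

(** The Boolean operations are determined by the order, so a surjective order embedding preserves
    all of them. *)
Lemma ba_isomorphismP d d' (A : ctbDistrLatticeType d)
    (B : ctbDistrLatticeType d') (f : A -> B) :
  ba_isomorphism f <->
  (forall y, exists x, f x = y) /\ {mono f : x y / x <= y}.
Proof.
split=> [[[g fK gK] fI _ _ _]|[fsurj fle]].
  split=> [y|x y]; first by exists (g y).
  by rewrite !leEmeet -fI (can_eq fK).
have finj : injective f.
  by move=> x y fxy; apply: le_anti; rewrite -!fle fxy lexx.
have /choice[g gK] := fsurj.
have fI : {morph f : x y / x `&` y >-> x `&` y}.
  move=> x y; apply: le_anti; rewrite lexI !fle leIl leIr /=.
  by rewrite -[leLHS]gK fle lexI -!fle !gK leIl leIr.
have fU : {morph f : x y / x `|` y >-> x `|` y}.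
  move=> x y; apply: le_anti; rewrite leUx !fle leUl leUr !andbT.
  by rewrite -[leRHS]gK fle leUx -!fle !gK leUl leUr.
have f0 : f \bot = \bot.
  by apply: le_anti; rewrite le0x -[leRHS]gK fle le0x.
have f1 : f \top = \top.
  by apply: le_anti; rewrite lex1 -[leLHS]gK fle lex1.
split=> //; first by exists g => // x; apply: finj; rewrite gK.
(* One inequality comes from the images of [x] and its complement being disjoint, the other from
   their join being the top. *)
move=> x; apply: le_anti; rewrite -disj_leC -fI meetC meetxC f0 eqxx /=.
by rewrite -[f (~` x)]complK -disj_leC -complU -fU joinxC f1 compl1.
Qed.

Lemma ba_isomorphic_sym d d' (A : ctbDistrLatticeType d)
    (B : ctbDistrLatticeType d') : ba_isomorphic A B -> ba_isomorphic B A.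
Proof.
move=> [f fiso]; have [[g fK gK] _ _ _ _] := fiso.
have /ba_isomorphismP[_ fle] := fiso.
exists g; apply/ba_isomorphismP; split=> [x|x y]; first by exists (f x).
by rewrite -fle !gK.
Qed.

Lemma ba_isomorphic_trans d1 d2 d3 (A : ctbDistrLatticeType d1)
    (B : ctbDistrLatticeType d2) (C : ctbDistrLatticeType d3) :
  ba_isomorphic A B -> ba_isomorphic B C -> ba_isomorphic A C.
Proof.
move=> [f /ba_isomorphismP[fsurj fle]] [g /ba_isomorphismP[gsurj gle]].
exists (g \o f); apply/ba_isomorphismP; split=> [z|x y] /=.
  by have [y <-] := gsurj z; have [x <-] := fsurj y; exists x.
by rewrite gle fle.
Qed.

Lemma ba_prod_isomorphic (G : Type) (d d' : G -> Order.disp_t)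
    (A : forall g, ctbDistrLatticeType (d g))
    (B : forall g, ctbDistrLatticeType (d' g)) :
  (forall g, ba_isomorphic (A g) (B g)) ->
  ba_isomorphic (ba_prod A) (ba_prod B).
Proof.
move=> AB; pose f g := projT1 (cid (AB g)).
have fP g := (ba_isomorphismP (f g)).1 (projT2 (cid (AB g))).
exists (fun (x : ba_prod A) => (fun g => f g (x g)) : ba_prod B).
apply/ba_isomorphismP; split=> [y|x y].
  exists (fun g => projT1 (cid ((fP g).1 (y g)))).
  by apply: functional_extensionality_dep => g; case: cid.
by apply/ba_prod_leP/ba_prod_leP => xy g; have := xy g; rewrite (fP g).2.
Qed.

(** The infimum of a set is the supremum of its lower bounds. *)
Lemma supremums_ba_complete d (A : ctbDistrLatticeType d) :
  (forall S : set A, supremums S !=set0) -> ba_complete A.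
Proof.
move=> sup S; split=> //; have [m [mub mlub]] := sup (lbound S).
exists m; split=> [x Sx|x]; last exact: mub.
by apply: mlub => y; apply.
Qed.

End Isomorphisms.

(** * Regular open algebras: completeness, countable density, homeomorphisms and sums *)

Section RegularOpenSets.

Lemma RO_neq0P (X : topologicalType) (U : RO X) :
  (U != \bot)%O <-> RO_set U !=set0.
Proof.
split=> [U0|[x Ux]]; last by apply/eqP => U0; rewrite U0 in Ux.
apply: contrapT => /set0P/negP/negPn/eqP UE; move/eqP: U0; apply.
exact: RO_inj.
Qed.

Lemma RO_complete (X : topologicalType) : ba_complete (RO X).
Proof.
apply: supremums_ba_complete => S.
exists (MkRO (regopen_interior_closure (\bigcup_(U in S) RO_set U))).
split=> [U SU|V Vub]; apply/RO_leP => /=.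
  apply: (@subset_trans _ (interior (RO_set U))).
    by rewrite (iffLR (interior_id _) (RO_open U)).
  apply: interiorS; apply: subset_trans (@subset_closure _ _).
  exact: bigcup_sup.
rewrite -[X in _ `<=` X](RO_setP V); apply: interiorS; apply: closureS.
by apply: bigcup_sub => U /Vub /RO_leP.
Qed.

Lemma RO_countable_dense (X : topologicalType) : second_countable (T := X) ->
  exists S : set (RO X), countable S /\ ba_dense S.
Proof.
move=> [D cD [Dop Dnbhs]].
exists [set MkRO (regopen_interior_closure E) | E in D]; split.
  exact: sub_countable (card_image_le _ _) cD.
move=> U /RO_neq0P[x Ux].
have [E [DE Ex] EU] := Dnbhs x _ (open_nbhs_nbhs (conj (RO_open U) Ux)).
exists (MkRO (regopen_interior_closure E)); split; first by exists E.
  apply/RO_neq0P; exists x => /=.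
  have := Ex; rewrite -[X in X x](iffLR (interior_id _) (Dop _ DE)).
  by apply: interiorS; exact: subset_closure.
apply/RO_leP => /=; rewrite -[X in _ `<=` X](RO_setP U).
exact/interiorS/closureS.
Qed.

Section OpenContinuousMap.
Variables (X Y : topologicalType) (f : X -> Y).
(** This says that [f] is continuous and open, as homeomorphisms and the injections of summands are.
    Preimages along such maps commute with interior and closure. *)
Hypothesis fnbhs : forall x A, nbhs (f x) A <-> nbhs x (f @^-1` A).

Lemma preimage_interior A : f @^-1` interior A = interior (f @^-1` A).
Proof. by apply/seteqP; split=> x /fnbhs. Qed.

Lemma preimage_interior_closure A :
  f @^-1` interior (closure A) = interior (closure (f @^-1` A)).
Proof.
have clE (T : topologicalType) (C : set T) : closure C = ~` interior (~` C).
  by rewrite interiorC !setCK.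
by rewrite preimage_interior !clE -preimage_setC preimage_interior preimage_setC.
Qed.

Lemma regopen_preimage A : regopen A -> regopen (f @^-1` A).
Proof. by rewrite /regopen -preimage_interior_closure => ->. Qed.

Definition RO_preimage (U : RO Y) : RO X := MkRO (regopen_preimage (RO_setP U)).

End OpenContinuousMap.

Lemma homeomorphic_RO (X Y : topologicalType) :
  homeomorphic X Y -> ba_isomorphic (RO Y) (RO X).
Proof.
move=> [f [g [fK gK fct gct]]].
have fnbhs x A : nbhs (f x) A <-> nbhs x (f @^-1` A).
  split=> [|fA]; first exact: fct.
  suff -> : A = g @^-1` (f @^-1` A) by apply: gct; rewrite fK.
  by apply/seteqP; split=> y /=; rewrite gK.
have gnbhs x A : nbhs (g x) A <-> nbhs x (g @^-1` A).
  split=> [|gA]; first exact: gct.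
  suff -> : A = f @^-1` (g @^-1` A) by apply: fct; rewrite gK.
  by apply/seteqP; split=> y /=; rewrite fK.
exists (RO_preimage fnbhs); apply/ba_isomorphismP; split=> [U|U V].
  exists (RO_preimage gnbhs U); apply: RO_inj.
  by rewrite /= -comp_preimage; apply/seteqP; split=> x /=; rewrite fK.
apply/RO_leP/RO_leP => UV x /=; last exact: UV.
by have := UV (g x); rewrite /= gK.
Qed.

(** The isomorphism restricts a set to the summands. Regular openness can be tested on each summand,
    so any family of regular open sets glues to one of the sum. *)
Lemma RO_sum_isomorphic (G : choiceType) (Y : G -> topologicalType) :
  ba_isomorphic (RO {g : G & Y g}) (ba_prod (fun g => RO (Y g))).
Proof.
have inbhs g (y : Y g) (A : set {g : G & Y g}) :
  nbhs (existT Y g y) A <-> nbhs y (existT Y g @^-1` A) by [].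
exists (fun U => (fun g => RO_preimage (inbhs g) U) : ba_prod _).
apply/ba_isomorphismP; split=> [V|U W].
  pose U : set {g : G & Y g} := [set x | RO_set (V (projT1 x)) (projT2 x)].
  have rU : regopen U.
    apply/seteqP; split=> [] [g y].
      have := preimage_interior_closure (inbhs g) U.
      by move/seteqP => [/(_ y) + _] => /[apply]; rewrite (RO_setP (V g)).
    move=> Uy; have := preimage_interior_closure (inbhs g) U.
    by move/seteqP => [_ /(_ y)]; apply; rewrite (RO_setP (V g)).
  exists (MkRO rU); apply: functional_extensionality_dep => g.
  exact: RO_inj.
apply/ba_prod_leP/RO_leP => [UW [g y]|/[swap] g UW].
  by have /RO_leP := UW g; apply.
by apply/RO_leP => y; apply: UW.
Qed.

End RegularOpenSets.

(** * The space of branches and its regular open algebra *)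

Section Branches.
Context {d : Order.disp_t} {B : ctbDistrLatticeType d} (e : nat -> B).
Local Open Scope order_scope.

Fixpoint branch_meet (p : nat -> bool) (n : nat) : B :=
  if n is k.+1 then branch_meet p k `&` (if p k then e k else ~` e k) else \top.

Record branch : Type := Branch {
  branch_val :> nat -> bool;
  branch_meet_neq0 : forall n, branch_meet branch_val n != \bot }.

HB.instance Definition _ := gen_eqMixin branch.
HB.instance Definition _ := gen_choiceMixin branch.

(** The centre [p] need not be a branch: finite bit lists padded with [false] thus name all
    cylinders, which gives a countable base. *)
Definition cylinder (p : nat -> bool) (n : nat) : set branch :=
  [set q | forall i, (i < n)%N -> q i = p i].

Definition branch_nbhs (p : branch) : set_system branch :=
  [set A | exists n, cylinder p n `<=` A].

Lemma branch_inj (p q : branch) : (forall i, p i = q i) -> p = q.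
Proof.
case: p q => [p hp] [q hq] /= /funext pq; rewrite pq in hp *.
by congr Branch; exact: Prop_irrelevance.
Qed.

Lemma cylinder_le p n m : (n <= m)%N -> cylinder p m `<=` cylinder p n.
Proof. by move=> nm q qp i /leq_trans /(_ nm); exact: qp. Qed.

Lemma cylinder_refl (p : branch) n : cylinder p n p.
Proof. by []. Qed.

HB.instance Definition _ := hasNbhs.Build branch branch_nbhs.

Fact branch_nbhs_proper (p : branch) : ProperFilter (branch_nbhs p).
Proof.
apply: Build_ProperFilter_ex => [A [n pA]|].
  by exists p; apply/pA/cylinder_refl.
split; first by exists 0%N.
  move=> U V [n pU] [m pV]; exists (maxn n m) => q qp; split.
    by apply/pU/(cylinder_le (leq_maxl n m)).
  by apply/pV/(cylinder_le (leq_maxr n m)).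
by move=> U V UV [n pU]; exists n; exact: subset_trans UV.
Qed.

Fact branch_nbhs_singleton (p : branch) (A : set branch) :
  branch_nbhs p A -> A p.
Proof. by move=> [n]; apply; exact: cylinder_refl. Qed.

Fact branch_nbhs_nbhs (p : branch) (A : set branch) :
  branch_nbhs p A -> branch_nbhs p (branch_nbhs^~ A).
Proof.
move=> [n pA]; exists n => q qp; exists n => r rq; apply: pA => i ni.
by rewrite rq // qp.
Qed.

HB.instance Definition _ := Nbhs_isNbhsTopological.Build branch
  branch_nbhs_proper branch_nbhs_singleton branch_nbhs_nbhs.

Lemma branch_nbhsP (p : branch) (A : set branch) :
  nbhs p A <-> exists n, cylinder p n `<=` A.
Proof. by []. Qed.

Lemma clopen_cylinder p n : clopen (cylinder p n).
Proof.
split; first rewrite openE.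
  move=> q qp; apply/branch_nbhsP; exists n => r rq i ni.
  by rewrite rq // qp.
move=> q /(_ (cylinder q n)) [|r [rp rq] i ni].
  by apply/branch_nbhsP; exists n.
by rewrite -rq // rp.
Qed.

Lemma branch_second_countable : second_countable (T := branch).
Proof.
exists (range (fun s => cylinder (nth false s) (size s))).
  exact: sub_countable (card_image_le _ _) (countableP _).
split=> [_ [s _ <-]|p A].
  by have [] := clopen_cylinder (nth false s) (size s).
move=> /branch_nbhsP[n pA].
have pE : cylinder (nth false (mkseq p n)) (size (mkseq p n)) = cylinder p n.
  by rewrite size_mkseq; apply/seteqP; split=> q qp i ni;
    rewrite qp // nth_mkseq.
exists (cylinder p n) => //; split; last exact: cylinder_refl.
by exists (mkseq p n).
Qed.

Lemma branch_meet_le p n m : (n <= m)%N -> branch_meet p m <= branch_meet p n.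
Proof.
move=> /subnK <-; elim: (m - n)%N => [|k IH] /=; first exact: lexx.
by rewrite leIxl.
Qed.

Lemma eq_branch_meet (p q : nat -> bool) n :
  (forall i, (i < n)%N -> q i = p i) -> branch_meet q n = branch_meet p n.
Proof.
elim: n => //= n IH qp; rewrite qp // IH // => i ni.
by rewrite qp // ltnS ltnW.
Qed.

Lemma branch_meet_disjoint (p q : nat -> bool) n i :
  (i < n)%N -> q i != p i -> branch_meet p n `&` branch_meet q n = \bot.
Proof.
move=> /[dup] ni; move=> /branch_meet_le ple qp.
apply/eqP; rewrite -lex0; apply: le_trans (leI2 (ple p) (ple q)) _ => /=.
rewrite meetACA (_ : _ `&` (if q i then _ else _) = \bot) ?meetx0 //.
by case: (p i) (q i) qp => [] [] // _; rewrite ?meetxC // meetC meetxC.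
Qed.

(* At stage [n], [e n] is accepted whenever it meets what remains of [a], and
   its complement otherwise; the remainder thus never vanishes. *)
Lemma branch_through (a : B) : a != \bot ->
  exists q : branch, forall n, branch_meet q n `&` a != \bot.
Proof.
move=> a0.
pose x := fix x n : B := if n is k.+1
  then if x k `&` e k != \bot then x k `&` e k else x k `&` ~` e k else a.
have x0 n : x n != \bot.
  elim: n => //= n IH; case: ifPn => // /negPn; rewrite disj_leC => xe.
  by rewrite (elimT meet_idPl xe).
pose q n := x n `&` e n != \bot.
have xle n : x n <= branch_meet q n `&` a.
  elim: n => [|n IH] /=; first by rewrite meet1x.
  rewrite meetAC; move: IH; rewrite /q; case: ifP => _ IH; exact: leI2.
have q0 n : branch_meet q n `&` a != \bot.
  by apply: contra_neq (x0 n) => h; apply/eqP; rewrite -lex0 -h.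
have qm n : branch_meet q n != \bot.
  by apply: contra_neq (q0 n) => ->; rewrite meet0x.
by exists (Branch qm).
Qed.

(** If [q] left [p] before stage [n], its meet at [n] would be disjoint from [branch_meet p n],
    hence from [a]. *)
Lemma branch_meet_cylinder (p : nat -> bool) (q : branch) n a :
  a <= branch_meet p n -> (forall m, branch_meet q m `&` a != \bot) ->
  cylinder p n q.
Proof.
move=> ap qa i ni; apply/eqP; move: (qa n); apply: contra_neqT => qp.
apply/eqP; rewrite -lex0 -(branch_meet_disjoint ni qp) meetC.
by apply: leI2.
Qed.

Definition branch_open (b : B) : set branch :=
  [set p | exists n, branch_meet p n <= b].

Lemma branch_openS b c : b <= c -> branch_open b `<=` branch_open c.
Proof. by move=> bc p [n pb]; exists n; exact: le_trans bc. Qed.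

Lemma open_branch_open b : open (branch_open b).
Proof.
rewrite openE => p [n pb]; apply/branch_nbhsP; exists n => q qp.
by exists n; rewrite (eq_branch_meet qp).
Qed.

(** At the larger of the two stages, a common branch would have a nonzero meet below both [b] and
    [c]. *)
Lemma branch_open_disjoint b c p : b `&` c = \bot ->
  branch_open b p -> branch_open c p -> False.
Proof.
move=> bc [n pb] [m pc]; have /negP := branch_meet_neq0 p (maxn n m).
apply; rewrite -lex0 -bc lexI.
rewrite (le_trans _ pb) ?(le_trans _ pc) // branch_meet_le //.
  exact: leq_maxr.
exact: leq_maxl.
Qed.

Hypothesis e_dense : forall a, a != \bot -> exists k, e k != \bot /\ e k <= a.

(** A branch through some [e k] below [a] has to accept [e k], since otherwise its meet at [k.+1]
    would miss [e k]. That meet is therefore below [a]. *)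
Lemma branch_open_neq0 a : a != \bot -> branch_open a !=set0.
Proof.
move=> /e_dense[k [ek0 eka]]; have [q qe] := branch_through ek0.
exists q, k.+1; move: (qe k.+1) => /=; case: (q k) => [_|].
  by rewrite leIxr.
by rewrite -meetA (meetC (~` _)) meetxC meetx0 eqxx.
Qed.

Lemma regopen_branch_open b : regopen (branch_open b).
Proof.
apply/seteqP; split=> [p|]; last first.
  rewrite -{1}(iffLR (interior_id _) (@open_branch_open b)).
  by apply: interiorS; exact: subset_closure.
(* Otherwise the part of [branch_meet p n] outside [b] is nonzero and yields a branch [q] in the
   cylinder of [p]. Then [q] is in the closure of [branch_open b], yet has a neighbourhood disjoint
   from that set. *)
move=> /branch_nbhsP[n pcl]; exists n; apply: contrapT => /negP pb.
have : branch_meet p n `&` ~` b != \bot by rewrite disj_leC complK.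
move=> /branch_open_neq0[q qpb].
have qp : cylinder p n q.
  move=> i ni; apply/eqP; apply: contrapT => /negP qp.
  apply: (@branch_open_disjoint (branch_meet p n) (branch_meet q n) q).
  - exact: branch_meet_disjoint ni qp.
  - by apply: branch_openS qpb; exact: leIl.
  - by exists n.
have qb : branch_open (~` b) q by apply: branch_openS qpb; exact: leIr.
have [r [rb rb']] := pcl q qp _ (open_nbhs_nbhs (conj (@open_branch_open _) qb)).
exact: (branch_open_disjoint (meetxC b)) rb rb'.
Qed.

Lemma RO_branch_isomorphic : ba_complete B -> ba_isomorphic B (RO branch).
Proof.
move=> Bcomplete; exists (fun b => MkRO (regopen_branch_open b)).
apply/ba_isomorphismP; split=> [U|b c]; last first.
  apply/RO_leP/idP => /= [bc|]; last exact: branch_openS.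
  apply: contrapT => /negP; rewrite -[c in _ <= c]complK -disj_leC.
  move=> /branch_open_neq0[q qbc].
  apply: (branch_open_disjoint (meetxC c) (p := q)).
    by apply: bc; apply: branch_openS qbc; exact: leIl.
  by apply: branch_openS qbc; exact: leIr.
(* The preimage of [U] will be the join of the meets whose cylinders lie inside [U]. *)
pose S := [set a | exists (p : branch) n,
  a = branch_meet p n /\ cylinder p n `<=` RO_set U].
have [[b [bub blub]] _] := Bcomplete S.
exists b; apply: RO_inj; apply/seteqP; split=> [/= | p Up] /=; last first.
  have /branch_nbhsP[n pU] := open_nbhs_nbhs (conj (RO_open U) Up).
  by exists n; apply: bub; exists p, n.
rewrite -[X in _ `<=` X](RO_setP U) -open_subsetE; last exact: open_branch_open.
(* If [N] missed [U], the meet of [p] at [maxn n m] would be disjoint from every member of [S],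
   hence from the join [b]; being also below [b], it would vanish. *)
move=> p [n pb] N /branch_nbhsP[m pN]; apply: contrapT => UN.
have {pb} : branch_meet p (maxn n m) <= b.
  by apply: le_trans pb; apply: branch_meet_le; exact: leq_maxl.
apply/negP; apply: contra (branch_meet_neq0 p (maxn n m)) => pb.
rewrite -[X in X == _]meetxx disj_leC (le_trans pb) //.
apply: blub => _ [q [k [-> qU]]]; rewrite lexC -disj_leC.
(* A nonzero overlap would carry a branch [r] in both cylinders, hence in both [U] and [N]. *)
apply: contrapT => /negP /branch_through[r rpq]; apply: UN.
exists r; split.
  by apply: qU; apply: branch_meet_cylinder rpq; exact: leIr.
apply/pN/(cylinder_le (leq_maxr n m)).
apply: branch_meet_cylinder rpq; exact: leIl.
Qed.

End Branches.

(** * Separation properties of topological sums *)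

Section Sums.

(** Zero-dimensionality: it yields regularity and passes to sums summand by summand. *)
Definition clopen_nbhs_base (T : topologicalType) :=
  forall (x : T) (A : set T), nbhs x A ->
    exists U : set T, [/\ clopen U, U x & U `<=` A].

Lemma clopen_nbhs_base_regular (T : topologicalType) :
  clopen_nbhs_base T -> regular_space T.
Proof.
move=> Tclopen x A /Tclopen[U [[Uop Ucl] Ux UA]].
exists U; first exact: open_nbhs_nbhs.
by rewrite -(iffLR (closure_id _) Ucl).
Qed.

Variables (G : choiceType) (Y : G -> topologicalType).

Lemma sigT_clopen_nbhs_base :
  (forall g, clopen_nbhs_base (Y g)) -> clopen_nbhs_base {g : G & Y g}.
Proof.
move=> Yclopen [g y] A /Yclopen[U [[Uop Ucl] Uy UA]].
exists (existT Y g @` U); split; [split|by exists y|by move=> _ [z /UA + <-]].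
  exact: existT_open_map.
rewrite -openC; apply/sigT_openP => h; have [<-|gh] := pselect (g = h).
  rewrite (_ : _ @^-1` _ = ~` U); first by rewrite openC.
  apply/seteqP; split=> z Uz /=; first by move=> Uz'; apply: Uz; exists z.
  by move=> [z' + zz']; rewrite (existT_inj2 zz').
rewrite (_ : _ @^-1` _ = setT); first exact: openT.
by apply/seteqP; split=> // z _ [z' _ zz']; exact/gh/(existT_inj1 zz').
Qed.

Lemma sigT_hausdorff :
  (forall g, hausdorff_space (Y g)) -> hausdorff_space {g : G & Y g}.
Proof.
move=> Yhaus [g y] [h z] clyz.
(* Whole summands serve as neighbourhoods here; that they meet forces the two indices to agree. *)
have [_ [[y' _ <-] [z' _ zy']]] := clyz _ _
  (existT_nbhs _ _ _ (filterT : nbhs y setT))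
  (existT_nbhs _ _ _ (filterT : nbhs z setT)).
have hg := existT_inj1 zy'.
(* The data over [g] are generalised so that eliminating [hg] moves them to the summand of [h]. *)
case: _ / hg y clyz y' zy' => y clyz _ _; congr existT; apply: Yhaus => A C yA zC.
have [_ [[a Aa <-] [c Cc ca]]] :=
  clyz _ _ (existT_nbhs _ _ _ yA) (existT_nbhs _ _ _ zC).
by exists a; split=> //; rewrite -(existT_inj2 ca).
Qed.

End Sums.

(** * Membership of sums of branch spaces in [M_plus] *)

Lemma branch_clopen_nbhs_base d (B : ctbDistrLatticeType d) (e : nat -> B) :
  clopen_nbhs_base (branch e).
Proof.
move=> p A /branch_nbhsP[n pA]; exists (cylinder p n).
by split=> //; exact: clopen_cylinder.
Qed.

Lemma branch_hausdorff d (B : ctbDistrLatticeType d) (e : nat -> B) :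
  hausdorff_space (branch e).
Proof.
move=> p q clpq; apply: branch_inj => i.
have [||r [rp rq]] := clpq (cylinder p i.+1) (cylinder q i.+1).
- by apply/branch_nbhsP; exists i.+1.
- by apply/branch_nbhsP; exists i.+1.
by rewrite -rp // rq.
Qed.

Lemma sum_branch_M_plus (G : choiceType) (d : G -> Order.disp_t)
    (B : forall g, ctbDistrLatticeType (d g)) (e : forall g, nat -> B g) :
  M_plus {g : G & branch (e g)}.
Proof.
split.
- apply/clopen_nbhs_base_regular/sigT_clopen_nbhs_base => g.
  exact: branch_clopen_nbhs_base.
- by apply: sigT_hausdorff => g; exact: branch_hausdorff.
exists G, (fun g => branch (e g)); split.
  by move=> g; exact: branch_second_countable.
by exists id, id; split=> // x A; exact.
Qed.

(** * Enumeration of dense subsets, and the characterisation *)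

Lemma countable_dense_sequence d (B : ctbDistrLatticeType d) :
  (exists S : set B, countable S /\ ba_dense S) ->
  exists e : nat -> B,
    forall a, (a != \bot)%O -> exists k, (e k != \bot)%O /\ (e k <= a)%O.
Proof.
move=> [S [/pfcard_geP[S0|[e]] dS]].
  (* An empty dense subset forces the algebra to be degenerate, so the constant sequence works
     vacuously. *)
  by exists (fun=> \bot%O) => a /dS[b []]; rewrite S0.
exists e => a /dS[b [/(@surj _ _ _ _ e)[k _ <-] ek0 eka]]; by exists k.
Qed.

Theorem theorem6p11 (d : Order.disp_t) (A : ctbDistrLatticeType d) :
  BM_plus A <->
  exists (G : Type) (dB : G -> Order.disp_t)
         (B : forall g : G, ctbDistrLatticeType (dB g)),
    (forall g : G, ba_complete (B g) /\
       exists S : set (B g), countable S /\ ba_dense S) /\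
    ba_isomorphic A (ba_prod B).
Proof.
split=> [[X [_ _ [G [Y [Ysc XY]]]] AX]|[G [dB [B [BP AB]]]]].
  exists G, (fun=> RO_display), (fun g => RO (Y g)); split=> [g|].
    by split; [exact: RO_complete|exact: RO_countable_dense].
  apply: ba_isomorphic_trans AX (ba_isomorphic_trans _ (RO_sum_isomorphic _)).
  exact/ba_isomorphic_sym/homeomorphic_RO.
have /(_ _)/cid eP g := countable_dense_sequence (BP g).2.
(* A topological sum is indexed by a [choiceType]; [{classic G}] makes one of the arbitrary type
   [G]. *)
pose e (g : {classic G}) := projT1 (eP g).
exists {g : {classic G} & branch (e g)}; first exact: sum_branch_M_plus.
apply: ba_isomorphic_trans AB _.
apply: ba_isomorphic_trans (ba_isomorphic_sym (RO_sum_isomorphic _)).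
apply: ba_prod_isomorphic => g.
exact: RO_branch_isomorphic (projT2 (eP g)) (BP g).1.
Qed.
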